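(* Let $\mathcal C$ be an admissible class of graphons, and let $H$ be a $\mathcal C$-Sidorenko graph. Put $v=v(H)$, $e=e(H)$, $s=2e-v$, and assume $v\le e$. Let $W\in\mathcal C$ (on $(\Omega,\mu)$) be non-zero, put $p=p(W)$, and define $$R=R_H(W)=\frac{t(H,W)}{p(W)^e}.$$ Then $$\left\|\frac{\deg_W}{p}-\mathbf 1\right\|_2^2\le R^{2/s}-1.$$ Consequently, for every measurable $A\subseteq\Omega$, $$\left|\int_{A\times\Omega}W(x,y)\,d\mu(x)\,d\mu(y)-p\,\mu(A)\right|\le p\sqrt{\mu(A)(1-\mu(A))}\,\sqrt{R^{2/s}-1}.$$
   Context: All underlying probability spaces $(\Omega,\mu)$ are standard and atomless (so isomorphic to $[0,1]$ with Lebesgue measure). A graphon is a symmetric measurable function $W:\Omega^2\to[0,1]$ on such a space; non-zero means not almost everywhere $0$. Graphs are finite and simple, with at least one edge; isolated vertices are deleted, so $v(H)$ denotes the number of non-isolated vertices of $H$ and $e(H)$ the number of edges. The homomorphism density is $t(H,W)=\int_{\Omega^{V(H)}}\prod_{uv\in E(H)}W(x_u,x_v)\prod_{u\in V(H)}d\mu(x_u)$, and $p(W)=t(K_2,W)=\int_{\Omega^2}W\,d\mu\,d\mu$. The degree function is $\deg_W(x)=\int_\Omega W(x,y)\,d\mu(y)$, $\mathbf 1$ is the constant function $1$, and $\|\cdot\|_2$ is the norm of $L^2(\Omega,\mu)$. For $k\ge1$, the tensor power $W^{\otimes k}$ is the graphon on $(\Omega^k,\mu^k)$ given by $W^{\otimes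 k}(x,y)=\prod_{r=1}^kW(x_r,y_r)$. For measurable $S\subseteq\Omega$ with $\alpha=\mu(S)>0$, the normalized principal restriction $W[S]$ is the graphon on $(S,\mu|_S/\alpha)$ given by $W[S](x,y)=W(x,y)$ for $x,y\in S$. A class $\mathcal C$ of graphons (considered up to measure-preserving isomorphism of the underlying standard atomless probability spaces) is admissible if: (A1) $W\in\mathcal C$ implies $W^{\otimes k}\in\mathcal C$ for every $k\ge1$; (A2) $W\in\mathcal C$ and $S$ a positive-measure measurable subset of the underlying space of $W$ imply $W[S]\in\mathcal C$. $H$ is $\mathcal C$-Sidorenko if $t(H,W)\ge p(W)^{e(H)}$ for every $W\in\mathcal C$. *)

(* Defs.v *)
From HB Require Import structures.
From mathcomp Require Import all_boot all_order all_algebra.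
From mathcomp Require Import all_classical all_reals all_analysis.
Set Implicit Arguments.
Unset Strict Implicit.
Unset Printing Implicit Defensive.
Import Order.TTheory GRing.Theory Num.Theory.
Import numFieldNormedType.Exports.

Local Open Scope classical_set_scope.
Local Open Scope ring_scope.

Section power_measure.
Context d (T : measurableType d) (R : realType) (P : probability T R).

Definition consT n (z : T * n.-tuple T) : n.+1.-tuple T := [tuple of z.1 :: z.2].

Lemma measurable_consT n : measurable_fun setT (@consT n).
Proof. by apply: measurable_cons; [exact: measurable_fst|exact: measurable_snd]. Qed.

HB.instance Definition _ n :=
  isMeasurableFun.Build _ _ _ _ (@consT n) (@measurable_consT n).

(* The product measure P^n on T^n, by recursion on n: the point mass for n = 0,
   then the image of P \x P^n under (x, t) |-> x :: t. *)
Fixpoint power_measure n : probability (n.-tuple T) R :=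
  if n is m.+1 then distribution (P \x power_measure m)%E (@consT m)
  else \d_([tuple] : 0.-tuple T).

End power_measure.

Section trace_space.
Context d (T : measurableType d) (R : realType) (P : probability T R).
Variables (S : set T) (mS : measurable S) (S0 : (0 < P S)%E).

Let nonempty : exists x : T, S x.
Proof.
apply: contrapT => Se; suff E : S = set0 by move: S0; rewrite E measure0 ltxx.
by apply/seteqP; split => // x Sx; apply: Se; exists x.
Qed.

Definition trace_carrier & measurable S & (0 < P S)%E : Type := set_type S.
Local Notation TS := (trace_carrier mS S0).

HB.instance Definition _ := Choice.on TS.
HB.instance Definition _ :=
  isPointed.Build TS (SigSub (mem_set (projT2 (cid nonempty)))).

Definition trace_val (x : TS) : T := \val (x : set_type S).

(* The subtype S, with the sets S `&` B (B measurable) as measurable sets. *)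
Definition trace_space : measurableType _ := g_sigma_algebra_preimageType trace_val.

Definition trace_fun (A : set trace_space) : \bar R :=
  (P (trace_val @` A) * ((fine (P S))^-1)%:E)%E.

Let trace_image (A : set trace_space) :
  measurable A -> measurable (trace_val @` A).
Proof.
move=> [B mB <-]; rewrite setTI (_ : _ @` _ = S `&` B); first exact: measurableI.
apply/seteqP; split => [_ [x /= Bx <-]|y [Sy By]].
  by split=> //; apply: set_mem; exact: (valP (x : set_type S)).
by exists (SigSub (mem_set Sy) : set_type S).
Qed.

Let trace_fun0 : trace_fun set0 = 0%E.
Proof. by rewrite /trace_fun image_set0 measure0 mul0e. Qed.

Let c_ge0 : 0 <= (fine (P S))^-1.
Proof. by rewrite invr_ge0 fine_ge0. Qed.

Let trace_fun_ge0 A : (0 <= trace_fun A)%E.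
Proof. by rewrite /trace_fun mule_ge0. Qed.

Let trace_fun_sigma_additive : semi_sigma_additive trace_fun.
Proof.
move=> F mF tF mU.
have inj : injective trace_val by exact: val_inj.
have H : (fun n => \sum_(0 <= i < n) P (trace_val @` F i))%E @ \oo -->
   P (trace_val @` (\bigcup_n F n)).
  rewrite image_bigcup; apply: measure_semi_sigma_additive.
  - by move=> i; exact: trace_image.
  - apply/trivIsetP => i j _ _ ij; apply/seteqP; split => // y.
    case=> -[x Fx <-] [x' Fx' /inj E]; move/trivIsetP : tF => /(_ i j I I ij).
    by move=> /seteqP[/(_ x) + _] => /(_ _)/=; apply; split=> //; rewrite -E.
  - by rewrite -image_bigcup; exact: trace_image.
rewrite /trace_fun (_ : (fun _ => _) = (fun n =>
  (\sum_(0 <= i < n) P (trace_val @` F i)) * ((fine (P S))^-1)%:E)%E).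
  by apply: cvgeZr.
by apply/funext => n; rewrite ge0_sume_distrl.
Qed.

HB.instance Definition _ := isMeasure.Build _ _ _ trace_fun
  trace_fun0 trace_fun_ge0 trace_fun_sigma_additive.

Let trace_funT : trace_fun setT = 1%E.
Proof.
have -> : trace_fun setT = (P S * ((fine (P S))^-1)%:E)%E.
  congr (P _ * _)%E; apply/seteqP; split => [_ [x _ <-]|y Sy].
    by apply: set_mem; exact: (valP (x : set_type S)).
  by exists (SigSub (mem_set Sy) : set_type S).
have PSf : P S \is a fin_num by exact: fin_num_measure.
rewrite -[X in (X * _)%E](fineK PSf) -EFinM divff// gt_eqF//.
by rewrite fine_gt0// S0/= ltey_eq PSf.
Qed.

HB.instance Definition _ :=
  Measure_isProbability.Build _ _ _ trace_fun trace_funT.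

Definition trace_measure : probability trace_space R := trace_fun.

End trace_space.

Record graphon (R : realType) := Graphon {
  gdisp : measure_display;
  gspace : measurableType gdisp;
  gmu : probability gspace R;
  gker :> gspace -> gspace -> R;
  gker_meas : measurable_fun setT (fun z : gspace * gspace => gker z.1 z.2);
  gker_sym : forall x y, gker x y = gker y x;
  gker01 : forall x y, 0 <= gker x y <= 1 }.

Section graphon_notions.
Context (R : realType).
Implicit Type W : graphon R.

(* X is Polish: the Hausdorff axiom makes its complete pseudometric a metric. *)
Definition standard_borel d (T : measurableType d) : Prop :=
  exists (X : completePseudoMetricType R) (f : T -> X),
    [/\ hausdorff_space X,
        exists2 D : set X, countable D & dense D,
        bijective f
      & forall A : set T, measurable A <-> <<s [set U : set X | open U] >> (f @` A)].

Definition atomless d (T : measurableType d) (P : probability T R) : Prop :=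
  forall A, measurable A -> (0 < P A)%E ->
    exists B, [/\ measurable B, B `<=` A, (0 < P B)%E & (P B < P A)%E].

Definition standard_atomless W : Prop :=
  standard_borel (gspace W) /\ atomless (gmu W).

(* Isomorphism modulo null sets of the underlying probability spaces. *)
Definition graphon_iso W V : Prop :=
  exists (f : gspace W -> gspace V) (g : gspace V -> gspace W),
    [/\ measurable_fun setT f /\ measurable_fun setT g,
        forall B, measurable B -> gmu W (f @^-1` B) = gmu V B,
        forall A, measurable A -> gmu V (g @^-1` A) = gmu W A,
        {ae gmu W, forall x, g (f x) = x} /\ {ae gmu V, forall y, f (g y) = y}
      & {ae (gmu W \x gmu W)%E, forall z, V (f z.1) (f z.2) = W z.1 z.2}].

Definition nonzero W : Prop :=
  ~ {ae (gmu W \x gmu W)%E, forall z, W z.1 z.2 = 0}.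

Definition edge_density W : R := \int[(gmu W \x gmu W)%E]_z W z.1 z.2.

Definition deg W (x : gspace W) : R := \int[gmu W]_y W x y.

Section tensor.
Variables (W : graphon R) (k : nat).

Definition tensor_ker (x y : k.-tuple (gspace W)) : R :=
  \prod_(r < k) W (tnth x r) (tnth y r).

Let tensor_meas : measurable_fun setT
  (fun z : k.-tuple (gspace W) * k.-tuple (gspace W) => tensor_ker z.1 z.2).
Proof.
apply: measurable_prod => i _.
have m : measurable_fun setT
    (fun z : k.-tuple (gspace W) * k.-tuple (gspace W) => (tnth z.1 i, tnth z.2 i)).
  apply/measurable_fun_pairP; split => /=.
    exact: (measurableT_comp (measurable_tnth i) measurable_fst).
  exact: (measurableT_comp (measurable_tnth i) measurable_snd).
exact: (measurableT_comp (@gker_meas _ W) m).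
Qed.

Let tensor_sym x y : tensor_ker x y = tensor_ker y x.
Proof. by apply: eq_bigr => i _; rewrite gker_sym. Qed.

Let tensor01 x y : 0 <= tensor_ker x y <= 1.
Proof.
apply/andP; split.
  by apply: prodr_ge0 => i _; have /andP[] := gker01 (tnth x i) (tnth y i).
by apply: prodr_ile1 => i _; exact: gker01.
Qed.

Definition tensor : graphon R :=
  @Graphon R _ _ (power_measure (gmu W) k) _ tensor_meas tensor_sym tensor01.

End tensor.

Section restriction.
Variables (W : graphon R) (S : set (gspace W)).
Variables (mS : measurable S) (S0 : (0 < gmu W S)%E).
Local Notation tval := (@trace_val _ _ _ (gmu W) S mS S0).

Definition restrict_ker (x y : trace_space mS S0) : R :=
  W (tval x) (tval y).

Let restrict_meas : measurable_fun setT
  (fun z : trace_space mS S0 * trace_space mS S0 => restrict_ker z.1 z.2).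
Proof.
have mv : measurable_fun setT (tval : trace_space mS S0 -> _).
  by move=> _ B mB; exists B.
have m : measurable_fun setT
    (fun z : trace_space mS S0 * trace_space mS S0 => (tval z.1, tval z.2)).
  apply/measurable_fun_pairP; split => /=.
    exact: (measurableT_comp mv measurable_fst).
  exact: (measurableT_comp mv measurable_snd).
exact: (measurableT_comp (@gker_meas _ W) m).
Qed.

Let restrict_sym x y : restrict_ker x y = restrict_ker y x.
Proof. exact: gker_sym. Qed.

Let restrict01 x y : 0 <= restrict_ker x y <= 1.
Proof. exact: gker01. Qed.

Definition restrict : graphon R :=
  @Graphon R _ _ (trace_measure mS S0) _ restrict_meas restrict_sym restrict01.

End restriction.

(* [graphon R] allows any underlying probability space, so the requirement that
   the spaces be standard and atomless is put on the members of the class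
   ([adm_standard]); [adm_iso] says that the class is considered up to
   isomorphism. *)
Record admissible (C : graphon R -> Prop) : Prop := {
  adm_standard : forall W, C W -> standard_atomless W;
  adm_iso : forall W V, C W -> standard_atomless V -> graphon_iso W V -> C V;
  adm_tensor : forall W k, C W -> (0 < k)%N -> C (tensor W k);
  adm_restrict : forall W (S : set (gspace W))
    (mS : measurable S) (S0 : (0 < gmu W S)%E), C W -> C (restrict mS S0) }.

End graphon_notions.

Arguments deg {R} W x.

Record sgraph := SGraph {
  vert : finType;
  adj : rel vert;
  adj_sym : symmetric adj;
  adj_irr : irreflexive adj;
  adj_nonempty : exists u v, adj u v }.

Section graph_notions.
Variable H : sgraph.

(* V(H) after deletion of the isolated vertices. *)
Definition core : finType := {u : vert H | [exists v, adj u v]}.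

Definition nverts : nat := #|core|.

(* Each edge once, as the pair of its end points in enumeration order. *)
Definition edges : {set core * core} :=
  [set uv | adj (val uv.1) (val uv.2) & (enum_rank uv.1 < enum_rank uv.2)%N].

Definition nedges : nat := #|edges|.

Context (R : realType).
Implicit Type W : graphon R.

Definition hom_density W : R :=
  \int[power_measure (gmu W) nverts]_x
    \prod_(uv in edges)
      W (tnth x (enum_rank uv.1)) (tnth x (enum_rank uv.2)).

Definition sidorenko (C : graphon R -> Prop) : Prop :=
  forall W, C W -> edge_density W ^+ nedges <= hom_density W.

Definition sidorenko_ratio W : R := hom_density W / edge_density W ^+ nedges.

End graph_notions.

(* Main.v *)
Require Import Defs.
From HB Require Import structures.
From mathcomp Require Import all_boot all_order all_algebra.
From mathcomp Require Import all_classical all_reals all_analysis.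
From mathcomp Require Import measurable_realfun zify ring lra.
Set Implicit Arguments.
Unset Strict Implicit.
Unset Printing Implicit Defensive.
Import Order.TTheory GRing.Theory Num.Theory.
Import numFieldNormedType.Exports.
Local Open Scope classical_set_scope.
Local Open Scope ring_scope.

(** Write [v], [e] for the numbers of vertices and edges of [H], [s = 2e - v],
    [t = t(H, W)], [d] for the degree function and [p] for the edge density.
    Since [d] has mean [p], the squared distance of [d / p] to [1] is
    [\int d^2 / p^2 - 1], so the first claim says [\int d^2 <= p^2 R^(2/s)].
    The second claim then follows from the Cauchy-Schwarz inequality applied
    to [1_A - mu(A)] and [d / p - 1], because the left-hand side is [p] times
    the integral of their product.

    Restricting to a set [U] and using the Sidorenko inequality there gives
    [(\int_(U x U) W)^e <= t mu(U)^s] ([sidorenko_restrict]).  Used directly,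
    this only sees the weight inside [U].  To see degrees, apply it to the
    tensor square, with [U] the union of [S x Omega] and [Omega x S]: the pairs
    from the first block to the second carry weight [(\int_S d)^2], while
    [U] has measure at most [2 mu(S)].  Hence
      [(\int_S d)^(2e) <= t^2 (2 mu(S))^s]   ([sidorenko_degree_sum]).
    For [S = {d > tau}] one has [tau mu(S) <= \int_S d <= p], and [e <= s]
    since [v <= e]; so with [B = p^2 R^(2/s)], that is
    [B^s = t^2 p^(2(s-e))], this becomes the weak-type bound
    [tau^2 mu(d > tau) <= 2 B] ([deg_weak_type]).

    Summing over dyadic levels [tau] bounds [\int d^2] by [B] up to a factor
    logarithmic in the truncation level ([deg_sqr_log]).  Both [\int d^2]
    and [B] are multiplicative under tensor powers, whereas for the [k]-th
    power the loss is only linear in [k]; it disappears after taking [k]-th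
    roots ([deg_sqr_le]). *)

(** * Integrals of bounded measurable functions on probability spaces *)

(** All integrands below are bounded, hence integrable for every probability
    measure; this class is closed under the operations needed, so that no
    integrability condition has to be carried around. *)
Definition bmfun d (T : measurableType d) (R : realType) (f : T -> R) : Prop :=
  measurable_fun setT f /\ exists M, forall x, `|f x| <= M.

Section bounded_measurable.
Context d (T : measurableType d) (R : realType).
Implicit Types (f g : T -> R).

Lemma bmfun_cst (c : R) : bmfun (fun _ : T => c).
Proof. by split; [exact: measurable_cst | exists `|c|]. Qed.

Lemma bmfunD f g : bmfun f -> bmfun g -> bmfun (fun x => f x + g x).
Proof.
move=> [mf [M fM]] [mg [N gN]]; split; first exact: measurable_funD.
by exists (M + N) => x; rewrite (le_trans (ler_normD _ _))// lerD.
Qed.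

Lemma bmfunM f g : bmfun f -> bmfun g -> bmfun (fun x => f x * g x).
Proof.
move=> [mf [M fM]] [mg [N gN]]; split; first exact: measurable_funM.
by exists (M * N) => x; rewrite normrM ler_pM.
Qed.

Lemma bmfunB f g : bmfun f -> bmfun g -> bmfun (fun x => f x - g x).
Proof.
move=> [mf [M fM]] [mg [N gN]]; split; first exact: measurable_funB.
by exists (M + N) => x; rewrite (le_trans (ler_normB _ _))// lerD.
Qed.

Lemma bmfunX f n : bmfun f -> bmfun (fun x => f x ^+ n).
Proof.
move=> bf; elim: n => [|n ih].
  by rewrite (_ : (fun _ => _) = fun=> 1);
    [exact: bmfun_cst|apply/funext => x; rewrite expr0].
rewrite (_ : (fun _ => _) = (fun x => f x * f x ^+ n)); first exact: bmfunM.
by apply/funext => x; rewrite exprS.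
Qed.

Lemma bmfun_indic (A : set T) : measurable A -> bmfun (\1_A : T -> R).
Proof.
move=> mA; split; first exact: measurable_indic.
by exists 1 => x; rewrite indicE; case: (x \in A); rewrite ?normr1 ?normr0.
Qed.

Lemma bmfun_sum I (r : seq I) (f : I -> T -> R) :
  (forall i, bmfun (f i)) -> bmfun (fun x => \sum_(i <- r) f i x).
Proof.
move=> bf; elim: r => [|i r ih].
  by rewrite (_ : (fun _ => _) = fun=> 0);
    [exact: bmfun_cst|apply/funext => x; rewrite big_nil].
rewrite (_ : (fun _ => _) = (fun x => f i x + \sum_(i <- r) f i x)).
  exact: bmfunD.
by apply/funext => x; rewrite big_cons.
Qed.

Lemma bmfun_prod (I : finType) (A : {pred I}) (f : I -> T -> R) :
  (forall i, bmfun (f i)) -> bmfun (fun x => \prod_(i in A) f i x).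
Proof.
move=> bf; rewrite (_ : (fun _ => _) = fun x => \prod_(i <- enum A) f i x);
  last first.
  by apply/funext => x; rewrite big_enum.
elim: (enum A) => [|i r ih].
  by rewrite (_ : (fun _ => _) = fun=> 1);
    [exact: bmfun_cst|apply/funext => x; rewrite big_nil].
rewrite (_ : (fun _ => _) = (fun x => f i x * \prod_(i <- r) f i x)).
  exact: bmfunM.
by apply/funext => x; rewrite big_cons.
Qed.

Lemma bmfun_comp d' (T' : measurableType d') (phi : T' -> T) f :
  bmfun f -> measurable_fun setT phi -> bmfun (fun x => f (phi x)).
Proof.
move=> [mf [M fM]] mphi; split; last by exists M => x; exact: fM.
exact: (measurableT_comp mf mphi).
Qed.

Lemma bmfun_itv01 f : measurable_fun setT f -> (forall x, 0 <= f x <= 1) ->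
  bmfun f.
Proof.
by move=> mf f01; split => //; exists 1 => x; have /andP[? ?] := f01 x;
  rewrite ger0_norm.
Qed.

Variable P : probability T R.

Lemma bmfun_integrable f : bmfun f -> P.-integrable setT (EFin \o f).
Proof.
move=> [mf [M fM]]; apply: (@le_integrable _ _ _ P setT measurableT _ (EFin \o cst M)).
- exact/measurable_EFinP.
- by move=> x _ /=; rewrite lee_fin (le_trans (fM x)) ?ler_norm.
- exact: finite_measure_integrable_cst.
Qed.

Lemma EFin_integral f : bmfun f ->
  (\int[P]_x f x)%:E = (\int[P]_x (f x)%:E)%E.
Proof.
by move=> bf; rewrite fineK//; apply: integrable_fin_num => //;
  exact: bmfun_integrable.
Qed.

Lemma bm_integralD f g : bmfun f -> bmfun g ->
  \int[P]_x (f x + g x) = \int[P]_x f x + \int[P]_x g x.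
Proof. by move=> bf bg; rewrite RintegralD//; exact: bmfun_integrable. Qed.

Lemma bm_integralB f g : bmfun f -> bmfun g ->
  \int[P]_x (f x - g x) = \int[P]_x f x - \int[P]_x g x.
Proof. by move=> bf bg; rewrite RintegralB//; exact: bmfun_integrable. Qed.

Lemma bm_integralZl (c : R) f : bmfun f ->
  \int[P]_x (c * f x) = c * \int[P]_x f x.
Proof. by move=> bf; rewrite RintegralZl//; exact: bmfun_integrable. Qed.

Lemma bm_integralZr (c : R) f : bmfun f ->
  \int[P]_x (f x * c) = (\int[P]_x f x) * c.
Proof. by move=> bf; rewrite RintegralZr//; exact: bmfun_integrable. Qed.

Lemma prob_integral_cst (c : R) : \int[P]_x c = c.
Proof. by rewrite Rintegral_cst//= (congr1 fine (probability_setT P)) mulr1. Qed.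

Lemma bm_integral_indic (A : set T) : measurable A ->
  \int[P]_x (\1_A x) = fine (P A).
Proof. by move=> mA; rewrite /Rintegral integral_indic// setIT. Qed.

Lemma bm_integral_le f g : bmfun f -> bmfun g -> (forall x, f x <= g x) ->
  \int[P]_x f x <= \int[P]_x g x.
Proof. by move=> bf bg fg; apply: le_Rintegral => //;
  exact: bmfun_integrable. Qed.

Lemma bm_integral_sum I (r : seq I) (f : I -> T -> R) :
  (forall i, bmfun (f i)) ->
  \int[P]_x (\sum_(i <- r) f i x) = \sum_(i <- r) \int[P]_x f i x.
Proof.
move=> bf; elim: r => [|i r ih].
  under eq_Rintegral do rewrite big_nil.
  by rewrite prob_integral_cst big_nil.
under eq_Rintegral do rewrite big_cons.
by rewrite bm_integralD ?ih ?big_cons//; exact: bmfun_sum.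
Qed.

End bounded_measurable.

Section fubini.
Context d1 d2 (T1 : measurableType d1) (T2 : measurableType d2) (R : realType).
Variables (P : probability T1 R) (Q : probability T2 R).
Variable (f : T1 * T2 -> R).
Hypothesis bf : bmfun f.

Let if_ : ((P \x Q)%E).-integrable setT (EFin \o f).
Proof. exact: bmfun_integrable. Qed.

Lemma bmfun_sectionl x : bmfun (fun y => f (x, y)).
Proof. by apply: (@bmfun_comp _ _ _ _ _ (fun y => (x, y))) => //;
  exact: pair1_measurable. Qed.

Lemma bmfun_sectionr y : bmfun (fun x => f (x, y)).
Proof. by apply: (@bmfun_comp _ _ _ _ _ (fun x => (x, y))) => //;
  exact: pair2_measurable. Qed.

Lemma bmfun_integral : bmfun (fun x => \int[Q]_y f (x, y)).
Proof.
split.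
  apply/measurable_EFinP.
  rewrite (_ : _ \o _ = (fun x => \int[Q]_y (f (x, y))%:E)%E); last first.
    by apply/funext => x /=; rewrite EFin_integral//; exact: bmfun_sectionl.
  exact: (measurable_fubini_F if_).
have [_ [M fM]] := bf; exists M => x.
rewrite (le_trans (le_normr_Rintegral _ _))//.
  by apply: bmfun_integrable; exact: bmfun_sectionl.
rewrite -[leRHS](prob_integral_cst Q); apply: bm_integral_le => //.
- have [mf _] := bmfun_sectionl x.
  by split; [exact: measurableT_comp|exists M => y; rewrite normr_id].
- exact: bmfun_cst.
Qed.

Lemma bm_fubini1 : \int[(P \x Q)%E]_z f z = \int[P]_x \int[Q]_y f (x, y).
Proof.
apply: EFin_inj; rewrite !EFin_integral//; last exact: bmfun_integral.
rewrite -(integral12_prod_meas1 if_); apply: eq_integral => x _.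
by rewrite EFin_integral//; exact: bmfun_sectionl.
Qed.

End fubini.

Section fubini_swap.
Context d1 d2 (T1 : measurableType d1) (T2 : measurableType d2) (R : realType).
Variables (P : probability T1 R) (Q : probability T2 R).
Variable (f : T1 * T2 -> R).
Hypothesis bf : bmfun f.

Let bswap : bmfun (fun z : T2 * T1 => f (z.2, z.1)).
Proof. by apply: (bmfun_comp bf); exact: measurable_swap. Qed.

Lemma bmfun_integralr : bmfun (fun y => \int[P]_x f (x, y)).
Proof. exact: (bmfun_integral Q P bswap). Qed.

Lemma bm_fubini : \int[P]_x \int[Q]_y f (x, y) = \int[Q]_y \int[P]_x f (x, y).
Proof.
apply: EFin_inj; rewrite !EFin_integral//; last 2 first.
- exact: bmfun_integralr.
- exact: bmfun_integral.
transitivity (\int[P]_x \int[Q]_y (f (x, y))%:E)%E.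
  by apply: eq_integral => x _; rewrite EFin_integral//; exact: bmfun_sectionl.
rewrite (@Fubini _ _ _ _ _ _ _ (EFin \o f)); last exact: bmfun_integrable.
by apply: eq_integral => y _; rewrite EFin_integral//; exact: bmfun_sectionr.
Qed.

End fubini_swap.

Lemma bm_integral_pushforward d1 d2 (X : measurableType d1)
    (Y : measurableType d2) (R : realType) (P : probability X R)
    (phi : {mfun X >-> Y}) (f : Y -> R) : bmfun f ->
  \int[distribution P phi]_y f y = \int[P]_x f (phi x).
Proof.
move=> bf; rewrite /Rintegral; congr fine.
rewrite integral_distribution//; first by apply/measurable_EFinP; have [] := bf.
by apply: (@bmfun_integrable _ _ _ P (f \o phi)); exact: bmfun_comp.
Qed.

(** * Product structure of the power measure *)

Section power_integral.
Context d (T : measurableType d) (R : realType).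

Lemma measurable_map_tuple d' (T' : measurableType d') n (g : T' -> T) :
  measurable_fun setT g ->
  measurable_fun setT (fun x : n.-tuple T' => [tuple of map g x]).
Proof.
move=> mg; apply/measurable_fun_tnthP => i.
rewrite (_ : _ \o _ = fun x : n.-tuple T' => g (tnth x i)); last first.
  by apply/funext => x; rewrite /= tnth_map.
exact: (measurableT_comp mg (measurable_tnth i)).
Qed.

Lemma measurable_thead n :
  measurable_fun setT (fun x : n.+1.-tuple T => thead x).
Proof. exact: measurable_tnth. Qed.

Lemma tnth_behead_lift n (x : n.+1.-tuple T) (i : 'I_n) :
  tnth [tuple of behead x] i = tnth x (lift ord0 i).
Proof.
rewrite tnth_behead; congr tnth.
by apply: val_inj; rewrite /= inordK ?ltnS ?ltn_ord.
Qed.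

Lemma measurable_behead n :
  measurable_fun setT (fun x : n.+1.-tuple T => [tuple of behead x] : n.-tuple T).
Proof.
apply/measurable_fun_tnthP => i.
rewrite (_ : _ \o _ = fun x : n.+1.-tuple T => tnth x (lift ord0 i)).
  exact: measurable_tnth.
by apply/funext => x /=; rewrite tnth_behead_lift.
Qed.

Variable P : probability T R.

Lemma bm_integral_power0 (F : 0.-tuple T -> R) : bmfun F ->
  \int[power_measure P 0]_x F x = F [tuple].
Proof.
move=> [mF _]; rewrite /Rintegral integral_dirac//; last exact/measurable_EFinP.
by rewrite diracT mul1e.
Qed.

Lemma bmfun_cons n (F : n.+1.-tuple T -> R) :
  bmfun F -> bmfun (fun z : T * n.-tuple T => F (consT z)).
Proof. by move=> bF; apply: (bmfun_comp bF); exact: measurable_consT. Qed.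

Lemma bmfun_consl n (F : n.+1.-tuple T -> R) a :
  bmfun F -> bmfun (fun t => F (consT (a, t))).
Proof. by move=> /bmfun_cons bF; exact: (bmfun_sectionl bF). Qed.

Lemma bm_integral_powerS n (F : n.+1.-tuple T -> R) : bmfun F ->
  \int[power_measure P n.+1]_x F x =
  \int[P]_a \int[power_measure P n]_t F (consT (a, t)).
Proof.
move=> bF; rewrite bm_integral_pushforward//.
by rewrite (bm_fubini1 P (power_measure P n) (bmfun_cons bF)).
Qed.

Lemma bmfun_integral_consT n (F : n.+1.-tuple T -> R) : bmfun F ->
  bmfun (fun a => \int[power_measure P n]_t F (consT (a, t))).
Proof. by move=> /bmfun_cons; exact: bmfun_integral. Qed.

Lemma thead_consT n (a : T) (t : n.-tuple T) : thead (consT (a, t)) = a.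
Proof. by []. Qed.

Lemma behead_consT n (a : T) (t : n.-tuple T) :
  [tuple of behead (consT (a, t))] = t.
Proof. exact: val_inj. Qed.

Lemma bmfun_tnth_prod n (f : 'I_n -> T -> R) : (forall i, bmfun (f i)) ->
  bmfun (fun x : n.-tuple T => \prod_i f i (tnth x i)).
Proof.
move=> bf; apply: bmfun_prod => i.
by apply: bmfun_comp => //; exact: measurable_tnth.
Qed.

Lemma bm_integral_power_prod n (f : 'I_n -> T -> R) :
  (forall i, bmfun (f i)) ->
  \int[power_measure P n]_x \prod_i f i (tnth x i) = \prod_i \int[P]_y f i y.
Proof.
elim: n f => [|n ih] f bf.
  rewrite big_ord0; under eq_Rintegral do rewrite big_ord0.
  by rewrite prob_integral_cst.
rewrite bm_integral_powerS; last exact: bmfun_tnth_prod.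
pose c := \prod_(i < n) \int[P]_y f (lift ord0 i) y.
transitivity (\int[P]_a (f ord0 a * c)).
  apply: eq_Rintegral => a _.
  rewrite /c -(ih (fun i => f (lift ord0 i)))// -bm_integralZl;
    last exact: (bmfun_tnth_prod (fun i => bf (lift ord0 i))).
  apply: eq_Rintegral => t _; rewrite big_ord_recl/=.
  by congr (_ * _); apply: eq_bigr => i _; rewrite tnthS.
by rewrite bm_integralZr// big_ord_recl.
Qed.

End power_integral.

Section power_split.
Context d (T : measurableType d) (R : realType) (P : probability T R).

Lemma map_consT d1 d2 (T1 : measurableType d1) (T2 : measurableType d2)
    (g : T1 -> T2) n a (t : n.-tuple T1) :
  [tuple of map g (consT (a, t))] = consT (g a, [tuple of map g t]).
Proof. exact: val_inj. Qed.

(** A family of [n] points of the [k+1]-st power splits into the family of its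
    heads and the family of its tails, which are independent.  This exchange of
    the two indices is what makes homomorphism densities multiplicative. *)
Lemma bm_integral_power_split n k (F : n.-tuple T -> R)
    (G : n.-tuple (k.-tuple T) -> R) : bmfun F -> bmfun G ->
  \int[power_measure (power_measure P k.+1) n]_x
     (F [tuple of map (@thead k T) x] *
      G [tuple of map (fun z : k.+1.-tuple T => [tuple of behead z] : k.-tuple T) x])
  = (\int[power_measure P n]_x F x) *
    (\int[power_measure (power_measure P k) n]_x G x).
Proof.
have bhd m (F' : m.-tuple T -> R) : bmfun F' ->
    bmfun (fun x : m.-tuple (k.+1.-tuple T) => F' [tuple of map (@thead k T) x]).
  move=> bF; apply: (bmfun_comp bF).
  by apply: measurable_map_tuple; exact: measurable_thead.
have btl m (G' : m.-tuple (k.-tuple T) -> R) : bmfun G' ->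
    bmfun (fun x : m.-tuple (k.+1.-tuple T) =>
      G' [tuple of map (fun z : k.+1.-tuple T => [tuple of behead z] : k.-tuple T) x]).
  move=> bG; apply: (bmfun_comp bG).
  by apply: measurable_map_tuple; exact: measurable_behead.
elim: n F G => [|n ih] F G bF bG.
  rewrite !bm_integral_power0//; last by apply: bmfunM; [exact: bhd|exact: btl].
  by congr (F _ * G _); exact: val_inj.
rewrite bm_integral_powerS; last by apply: bmfunM; [exact: bhd|exact: btl].
pose F1 a := \int[power_measure P n]_t F (consT (a, t)).
pose G1 b := \int[power_measure (power_measure P k) n]_t G (consT (b, t)).
transitivity (\int[power_measure P k.+1]_z (F1 (thead z) * G1 [tuple of behead z])).
  apply: eq_Rintegral => z _.
  rewrite -ih; last 2 first.
  - exact: bmfun_consl.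
  - exact: bmfun_consl.
  by apply: eq_Rintegral => x _; rewrite !map_consT.
have bF1 : bmfun F1 by exact: bmfun_integral_consT.
have bG1 : bmfun G1 by exact: bmfun_integral_consT.
rewrite bm_integral_powerS; last first.
  apply: bmfunM; first by apply: (bmfun_comp bF1); exact: measurable_thead.
  by apply: (bmfun_comp bG1); exact: measurable_behead.
transitivity (\int[P]_a (F1 a * \int[power_measure P k]_t G1 t)).
  apply: eq_Rintegral => a _; rewrite -bm_integralZl//.
  by apply: eq_Rintegral => t _; rewrite thead_consT behead_consT.
by rewrite bm_integralZr// !bm_integral_powerS.
Qed.

End power_split.

(** * Restriction to a subset *)

Section trace_integral.
Context d (T : measurableType d) (R : realType) (P : probability T R).
Variables (S : set T) (mS : measurable S) (S0 : (0 < P S)%E).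
Local Notation tval := (@trace_val _ _ _ P S mS S0).
Local Notation tmu := (trace_measure mS S0).

Lemma measurable_trace_val :
  measurable_fun setT (tval : trace_space mS S0 -> T).
Proof. by move=> _ B mB; exists B. Qed.

Lemma trace_valP x : S (tval x).
Proof. by apply: set_mem; exact: (valP (x : set_type S)). Qed.

Lemma fine_prob_gt0 : 0 < fine (P S).
Proof. by rewrite fine_gt0// S0/= ltey_eq fin_num_measure. Qed.

(** The image of the trace measure under the inclusion is carried by [S], where
    it is the measure [P] divided by [P S]. *)
Lemma bm_integral_trace (phi : T -> R) : bmfun phi -> (forall x, 0 <= phi x) ->
  fine (P S) * \int[tmu]_x phi (tval x) = \int[P]_x (\1_S x * phi x).
Proof.
move=> bphi phi0.
pose mixin := isMeasurableFun.Build _ _ _ _ _ measurable_trace_val.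
pose v : {mfun trace_space mS S0 >-> T} := HB.pack tval mixin.
have bS : bmfun (fun x => \1_S x * phi x) by apply: bmfunM => //;
  exact: bmfun_indic.
have mphi : measurable_fun S (EFin \o phi).
  by apply/measurable_funTS/measurable_EFinP; have [] := bphi.
have k0 : 0 <= (fine (P S))^-1 by rewrite invr_ge0 fine_ge0.
have sE : forall x, (\1_S x * phi x)%:E = ((EFin \o phi) \_ S) x.
  by move=> x; rewrite patchE indicE; case: ifPn => //= _; rewrite ?mul1r ?mul0r.
apply: EFin_inj; rewrite EFinM !EFin_integral//; last first.
  by apply: (bmfun_comp bphi); exact: measurable_trace_val.
rewrite (_ : (\int[tmu]_x _)%E = (\int[distribution tmu v]_x (\1_S x * phi x)%:E)%E); last first.
  rewrite integral_distribution//; last first.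
  - apply: (@bmfun_integrable _ _ _ tmu (fun x => \1_S (v x) * phi (v x))).
    by apply: (bmfun_comp bS); exact: measurable_trace_val.
  - by apply/measurable_EFinP; have [] := bS.
  apply: eq_integral => x _ /=.
  by rewrite indicE mem_set ?mul1r//; exact: trace_valP.
under eq_integral do rewrite sE.
under [RHS]eq_integral do rewrite sE.
(* Only now that the integrals range over S do the two measures agree. *)
rewrite -!integral_mkcond (eq_measure_integral (mscale (NngNum k0) P));
  last first.
  move=> A mA AS; rewrite /= /pushforward/= /trace_fun /mscale/= muleC.
  congr (_ * P _)%E; apply/seteqP; split => [_ [x Ax <-]//|y Ay].
  by exists (SigSub (mem_set (AS _ Ay)) : set_type S).
rewrite ge0_integral_mscale//; last by move=> x _; rewrite lee_fin.
by rewrite muleA -EFinM/= divff ?mul1e// gt_eqF// fine_prob_gt0.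
Qed.

Lemma power_trace_le n (F : n.-tuple T -> R) : bmfun F -> (forall x, 0 <= F x) ->
  fine (P S) ^+ n * \int[power_measure tmu n]_x F [tuple of map tval x] <=
  \int[power_measure P n]_x F x.
Proof.
have bmap m (F' : m.-tuple T -> R) : bmfun F' ->
    bmfun (fun x : m.-tuple (trace_space mS S0) => F' [tuple of map tval x]).
  move=> bF; apply: (bmfun_comp bF); apply: measurable_map_tuple.
  exact: measurable_trace_val.
elim: n F => [|n ih] F bF F0.
  rewrite expr0 mul1r !bm_integral_power0//; last exact: (bmap 0%N).
  by rewrite (_ : [tuple of _] = [tuple])//; exact: val_inj.
rewrite bm_integral_powerS; last exact: bmap.
rewrite [leRHS]bm_integral_powerS//.
pose F1 a := \int[power_measure P n]_t F (consT (a, t)).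
have bF1 : bmfun F1 by exact: bmfun_integral_consT.
have F10 a : 0 <= F1 a by apply: Rintegral_ge0.
have b2 := bmfun_integral_consT tmu (bmap _ _ bF).
have b3 : bmfun (fun x : trace_space mS S0 => F1 (tval x)).
  by apply: (bmfun_comp bF1); exact: measurable_trace_val.
apply: (@le_trans _ _ (fine (P S) * \int[tmu]_x F1 (tval x))).
  rewrite exprS -mulrA ler_pM2l ?fine_prob_gt0//.
  rewrite -bm_integralZl//; apply: bm_integral_le => //.
    by apply: bmfunM => //; exact: bmfun_cst.
  move=> x; under eq_Rintegral do rewrite map_consT.
  by apply: ih => //; exact: bmfun_consl.
rewrite bm_integral_trace//; apply: bm_integral_le => //.
  by apply: bmfunM => //; exact: bmfun_indic.
by move=> x; rewrite indicE -/(F1 x); case: (x \in S) => /=;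
  rewrite ?mul1r ?mul0r.
Qed.

End trace_integral.

(** * Densities and degrees of tensor powers and restrictions *)

Section graphon_lemmas.
Context (R : realType).
Implicit Type W : graphon R.

Lemma gker_ge0 W x y : 0 <= W x y.
Proof. by have /andP[] := @gker01 _ W x y. Qed.

Lemma gker_le1 W x y : W x y <= 1.
Proof. by have /andP[] := @gker01 _ W x y. Qed.

Lemma bmfun_gker W :
  bmfun (fun z : gspace W * gspace W => W z.1 z.2).
Proof. by apply: bmfun_itv01 => [|x]; [exact: gker_meas|exact: gker01]. Qed.

Lemma bmfun_deg W : bmfun (deg W).
Proof. exact: (bmfun_integral (gmu W) (gmu W) (bmfun_gker W)). Qed.

Lemma edge_densityE W : edge_density W = \int[gmu W]_x deg W x.
Proof. exact: (bm_fubini1 _ _ (bmfun_gker W)). Qed.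

Lemma deg_ge0 W x : 0 <= deg W x.
Proof. by apply: Rintegral_ge0 => y _; exact: gker_ge0. Qed.

Lemma deg_le1 W x : deg W x <= 1.
Proof.
rewrite -[leRHS](prob_integral_cst (gmu W)); apply: bm_integral_le.
- exact: (bmfun_sectionl (bmfun_gker W)).
- exact: bmfun_cst.
- by move=> y; exact: gker_le1.
Qed.

Variable H : sgraph.

Definition hom_weight W (x : (nverts H).-tuple (gspace W)) : R :=
  \prod_(uv in edges H) W (tnth x (enum_rank uv.1)) (tnth x (enum_rank uv.2)).

Lemma bmfun_hom_weight W : bmfun (@hom_weight W).
Proof.
apply: bmfun_prod => uv.
apply: (bmfun_comp (phi := fun x : (nverts H).-tuple (gspace W) =>
  (tnth x (enum_rank uv.1), tnth x (enum_rank uv.2))) (bmfun_gker W)).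
by apply: measurable_fun_pair; exact: measurable_tnth.
Qed.

Lemma hom_weight_ge0 W x : 0 <= @hom_weight W x.
Proof. by apply: prodr_ge0 => uv _; exact: gker_ge0. Qed.

Lemma hom_density_tensor W k : hom_density H (tensor W k) = hom_density H W ^+ k.
Proof.
elim: k => [|k ih].
  rewrite expr0 -(prob_integral_cst (power_measure (gmu (tensor W 0)) (nverts H)) 1).
  apply: eq_Rintegral => x _; rewrite big1// => uv _.
  by rewrite /= /tensor_ker big_ord0.
rewrite exprS -ih.
rewrite -(@bm_integral_power_split _ _ _ (gmu W) (nverts H) k
  (@hom_weight W) (@hom_weight (tensor W k))); last 2 first.
- exact: (bmfun_hom_weight W).
- exact: (bmfun_hom_weight (tensor W k)).
apply: eq_Rintegral => x _; rewrite /hom_weight -big_split/=.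
apply: eq_bigr => uv _; rewrite !tnth_map /tensor_ker big_ord_recl; congr (_ * _).
by apply: eq_bigr => i _; rewrite !tnth_behead_lift.
Qed.

(** The left-hand side is the part of the integral defining [hom_density H W]
    where all vertices are mapped into [S]. *)
Lemma hom_density_restrict W (S : set (gspace W)) (mS : measurable S)
    (S0 : (0 < gmu W S)%E) :
  fine (gmu W S) ^+ nverts H * hom_density H (Defs.restrict mS S0) <= hom_density H W.
Proof.
apply: (le_trans _ (power_trace_le mS S0 (bmfun_hom_weight W) (@hom_weight_ge0 W))).
rewrite ler_pM2l ?exprn_gt0 ?fine_prob_gt0//.
rewrite le_eqVlt; apply/orP; left; apply/eqP.
by apply: eq_Rintegral => x _; apply: eq_bigr => uv _; rewrite !tnth_map.
Qed.

End graphon_lemmas.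

Section density_lemmas.
Context (R : realType).
Implicit Type W : graphon R.

Lemma edge_density_restrict W (S : set (gspace W)) (mS : measurable S)
    (S0 : (0 < gmu W S)%E) :
  fine (gmu W S) ^+ 2 * edge_density (Defs.restrict mS S0) =
  \int[gmu W]_x \int[gmu W]_y (\1_S x * \1_S y * W x y).
Proof.
have bS : bmfun (\1_S : _ -> R) by exact: bmfun_indic.
have bSy : bmfun (fun z : gspace W * gspace W => \1_S z.2 * W z.1 z.2 : R).
  by apply: bmfunM (bmfun_gker W); exact: (bmfun_comp bS).
have bI := bmfun_integral (gmu W) (gmu W) bSy.
transitivity (\int[gmu W]_x (\1_S x * \int[gmu W]_y (\1_S y * W x y)));
  last first.
  apply: eq_Rintegral => x _; rewrite -bm_integralZl;
    last exact: (bmfun_sectionl bSy).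
  by apply: eq_Rintegral => y _; rewrite mulrA.
rewrite -(bm_integral_trace mS S0 bI); last first.
  move=> x; apply: Rintegral_ge0 => y _; apply: mulr_ge0; first by rewrite indicE.
  exact: gker_ge0.
rewrite expr2 -mulrA; congr (_ * _).
rewrite edge_densityE -bm_integralZl; last exact: bmfun_deg.
apply: eq_Rintegral => x _.
rewrite /= -(bm_integral_trace mS S0 (bmfun_sectionl (bmfun_gker W) _))//.
by move=> y; exact: gker_ge0.
Qed.

Lemma deg_tensor W k (x : gspace (tensor W k)) :
  deg (tensor W k) x = \prod_(i < k) deg W (tnth x i).
Proof.
rewrite -(bm_integral_power_prod _ (f := fun i => W (tnth x i)))// => i.
exact: (bmfun_sectionl (bmfun_gker W)).
Qed.

Lemma edge_density_tensor W k :
  edge_density (tensor W k) = edge_density W ^+ k.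
Proof.
rewrite !edge_densityE.
under eq_Rintegral do rewrite deg_tensor.
rewrite (bm_integral_power_prod _ (f := fun=> deg W));
  last by move=> i; exact: bmfun_deg.
by rewrite prodr_const card_ord.
Qed.

Lemma deg_sqr_tensor W k :
  \int[gmu (tensor W k)]_x deg (tensor W k) x ^+ 2 =
  (\int[gmu W]_x deg W x ^+ 2) ^+ k.
Proof.
under eq_Rintegral do rewrite deg_tensor -prodrXl.
rewrite (bm_integral_power_prod _ (f := fun=> fun x => deg W x ^+ 2)); last first.
  by move=> i; apply: bmfunX; exact: bmfun_deg.
by rewrite prodr_const card_ord.
Qed.

End density_lemmas.

(** * Degree sums from the tensor square *)

Section power2.
Context d (T : measurableType d) (R : realType) (P : probability T R).

Lemma bm_integral_power2 (f g : T -> R) : bmfun f -> bmfun g ->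
  \int[power_measure P 2]_x (f (tnth x ord0) * g (tnth x ord_max)) =
  (\int[P]_x f x) * (\int[P]_x g x).
Proof.
move=> bf bg; pose h (i : 'I_2) := if i == ord0 then f else g.
have bh i : bmfun (h i) by rewrite /h; case: ifP.
have := bm_integral_power_prod P bh.
rewrite big_ord_recl big_ord1 => <-.
by apply: eq_Rintegral => x _;
  rewrite big_ord_recl big_ord1; congr (_ * g (tnth _ _)); exact: val_inj.
Qed.

Lemma bm_integral_power2l (f : T -> R) : bmfun f ->
  \int[power_measure P 2]_x f (tnth x ord0) = \int[P]_x f x.
Proof.
move=> bf; rewrite -[RHS]mulr1 -[X in _ * X](prob_integral_cst P) -bm_integral_power2//.
  by apply: eq_Rintegral => x _; rewrite mulr1.
exact: bmfun_cst.
Qed.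

Lemma bm_integral_power2r (f : T -> R) : bmfun f ->
  \int[power_measure P 2]_x f (tnth x ord_max) = \int[P]_x f x.
Proof.
move=> bf; rewrite -[RHS]mul1r -[X in X * _](prob_integral_cst P) -bm_integral_power2//.
  by apply: eq_Rintegral => x _; rewrite mul1r.
exact: bmfun_cst.
Qed.

End power2.

Section cross.
Context (R : realType) (W : graphon R).
Variables (S : set (gspace W)) (mS : measurable S).
Local Notation V := (tensor W 2).

Definition cross : set (gspace V) := [set x | S (tnth x ord0) \/ S (tnth x ord_max)].

Lemma measurable_cross : measurable cross.
Proof.
apply: measurableU.
- rewrite -[X in measurable X]setTI; exact: (@measurable_tnth _ _ 2 ord0).
- rewrite -[X in measurable X]setTI; exact: (@measurable_tnth _ _ 2 ord_max).
Qed.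

Let bS : bmfun (\1_S : _ -> R). Proof. exact: bmfun_indic. Qed.
Let bU : bmfun (\1_cross : _ -> R).
Proof. by apply: bmfun_indic; exact: measurable_cross. Qed.
Let bS0 : bmfun (fun x : gspace V => \1_S (tnth x ord0) : R).
Proof. by apply: (bmfun_comp bS); exact: measurable_tnth. Qed.
Let bS1 : bmfun (fun x : gspace V => \1_S (tnth x ord_max) : R).
Proof. by apply: (bmfun_comp bS); exact: measurable_tnth. Qed.

Lemma indic_cross_ge0 (x : gspace V) : \1_S (tnth x ord0) <= \1_cross x :> R.
Proof.
rewrite !indicE; case: (boolP (_ \in S)) => [/set_mem Sx|//].
by rewrite mem_set//; left.
Qed.

Lemma indic_cross_ge1 (x : gspace V) : \1_S (tnth x ord_max) <= \1_cross x :> R.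
Proof.
rewrite !indicE; case: (boolP (_ \in S)) => [/set_mem Sx|//].
by rewrite mem_set//; right.
Qed.

Lemma prob_cross_ge : fine (gmu W S) <= fine (gmu V cross).
Proof.
rewrite -(bm_integral_indic (gmu W) mS) -(bm_integral_indic (gmu V) measurable_cross).
rewrite -(bm_integral_power2l (gmu W) bS).
by apply: bm_integral_le => // x; exact: indic_cross_ge0.
Qed.

Lemma prob_cross_le : fine (gmu V cross) <= 2 * fine (gmu W S).
Proof.
rewrite -(bm_integral_indic (gmu W) mS) -(bm_integral_indic (gmu V) measurable_cross).
rewrite mulrDl mul1r -{1}(bm_integral_power2l (gmu W) bS) -(bm_integral_power2r (gmu W) bS).
rewrite -bm_integralD//; apply: bm_integral_le => //; first exact: bmfunD.
move=> x; rewrite !indicE.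
case: (boolP (x \in cross)) => [/set_mem|]; last by rewrite addr_ge0.
by case=> /mem_set ->; rewrite ?lerDl ?lerDr.
Qed.

(** Keep only the pairs [x], [y] with the first coordinate of [x] and the second
    coordinate of [y] in [S].  Integrating over [y] leaves the degree of [x_0] in
    [W] times the degree of [x_1] into [S]; each of the two factors integrates to
    the degree sum of [S], the second one by symmetry of [W]. *)
Lemma cross_weight_ge :
  (\int[gmu W]_x (\1_S x * deg W x)) ^+ 2 <=
  \int[gmu V]_x \int[gmu V]_y (\1_cross x * \1_cross y * V x y).
Proof.
have bW := bmfun_gker W; have bV := bmfun_gker V.
pose g (a b : gspace W) : R := \1_S b * W a b.
have bg : bmfun (fun z => g z.1 z.2).
  by apply: bmfunM => //; exact: (bmfun_comp bS).
have bh := bmfun_integral (gmu W) (gmu W) bg.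
have b1 : bmfun (fun x => \1_S x * deg W x).
  by apply: bmfunM => //; exact: bmfun_deg.
have hE : \int[gmu W]_x \int[gmu W]_y g x y = \int[gmu W]_x (\1_S x * deg W x).
  rewrite (bm_fubini (gmu W) (gmu W) bg); apply: eq_Rintegral => y _.
  rewrite -bm_integralZl; last exact: (bmfun_sectionl bW).
  by apply: eq_Rintegral => x _; rewrite /g/= gker_sym.
rewrite expr2 -{2}hE -(bm_integral_power2 (gmu W) b1 bh).
have b2 : bmfun (fun z : gspace V * gspace V => \1_cross z.1 * \1_cross z.2 * V z.1 z.2).
  by apply: bmfunM => //; apply: bmfunM; exact: (bmfun_comp bU).
have b3 : bmfun (fun z : gspace V * gspace V =>
    \1_S (tnth z.1 ord0) * \1_S (tnth z.2 ord_max) * V z.1 z.2).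
  by apply: bmfunM => //; apply: bmfunM;
    [exact: (bmfun_comp bS0)|exact: (bmfun_comp bS1)].
apply: (@le_trans _ _ (\int[gmu V]_x \int[gmu V]_y
   (\1_S (tnth x ord0) * \1_S (tnth y ord_max) * V x y))).
  rewrite le_eqVlt; apply/orP; left; apply/eqP; apply: eq_Rintegral => x _.
  rewrite -mulrA -(bm_integral_power2 (gmu W) (bmfun_sectionl bW (tnth x ord0))
    (bmfun_sectionl bg (tnth x ord_max))).
  rewrite -bm_integralZl; last first.
    apply: bmfunM.
      by apply: (bmfun_comp (bmfun_sectionl bW (tnth x ord0)));
        exact: measurable_tnth.
    by apply: (bmfun_comp (bmfun_sectionl bg (tnth x ord_max)));
      exact: measurable_tnth.
  apply: eq_Rintegral => y _; rewrite /= /tensor_ker big_ord_recl big_ord1 /g/=.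
  rewrite (_ : lift ord0 ord0 = ord_max); last exact: val_inj.
  by ring.
apply: bm_integral_le.
- exact: (bmfun_integral (gmu V) (gmu V) b3).
- exact: (bmfun_integral (gmu V) (gmu V) b2).
move=> x; apply: bm_integral_le.
- exact: (bmfun_sectionl b3).
- exact: (bmfun_sectionl b2).
move=> y; apply: ler_wpM2r; first exact: gker_ge0.
by apply: ler_pM => //; [exact: indic_cross_ge0|exact: indic_cross_ge1].
Qed.

End cross.

Section sidorenko_bounds.
Context (R : realType) (C : graphon R -> Prop) (H : sgraph).
Hypothesis C_admissible : admissible C.
Hypothesis H_sidorenko : sidorenko H C.
Implicit Type W : graphon R.

Local Notation s := (2 * nedges H - nverts H)%N.

Lemma edge_density_ge0 W : 0 <= edge_density W.
Proof. by apply: Rintegral_ge0 => z _; exact: gker_ge0. Qed.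

Lemma hom_density_ge0 W : 0 <= hom_density H W.
Proof. by apply: Rintegral_ge0 => z _; exact: hom_weight_ge0. Qed.

(** The exponent [s] collects [-v] from the restriction of the homomorphism
    density and [2e] from the normalization of the [e] edge densities. *)
Lemma sidorenko_restrict W (S : set (gspace W)) (mS : measurable S)
    (S0 : (0 < gmu W S)%E) : (nverts H <= 2 * nedges H)%N -> C W ->
  (\int[gmu W]_x \int[gmu W]_y (\1_S x * \1_S y * W x y)) ^+ nedges H <=
  hom_density H W * fine (gmu W S) ^+ s.
Proof.
move=> vle CW; set a := fine (gmu W S).
have a0 : 0 < a by exact: fine_prob_gt0.
rewrite -(edge_density_restrict mS S0) exprMn -exprM -{1}(subnKC vle) exprD.
rewrite mulrAC ler_pM2r ?exprn_gt0//.
apply: le_trans (hom_density_restrict H mS S0).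
by rewrite ler_pM2l ?exprn_gt0//; apply: H_sidorenko; exact: adm_restrict.
Qed.

(** [sidorenko_restrict] for the tensor square and the set [cross S]. *)
Lemma sidorenko_degree_sum W (S : set (gspace W)) :
  (nverts H <= 2 * nedges H)%N -> C W -> measurable S -> (0 < gmu W S)%E ->
  (\int[gmu W]_x (\1_S x * deg W x)) ^+ (2 * nedges H) <=
  hom_density H W ^+ 2 * (2 * fine (gmu W S)) ^+ s.
Proof.
move=> vle CW mS S0.
have C2 : C (tensor W 2) by exact: adm_tensor.
have a0 := fine_prob_gt0 mS S0.
have U0 : (0 < gmu (tensor W 2) (cross S))%E.
  rewrite -(fineK (fin_num_measure _ _ (measurable_cross mS))) lte_fin.
  by apply: lt_le_trans (prob_cross_ge mS).
rewrite exprM -hom_density_tensor.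
have w0 : 0 <= (\int[gmu W]_x (\1_S x * deg W x)) ^+ 2 by exact: sqr_ge0.
apply: (le_trans (lerXn2r _ _ _ (cross_weight_ge mS))).
- by rewrite nnegrE.
- by rewrite nnegrE (le_trans w0)// cross_weight_ge.
apply: (le_trans (sidorenko_restrict (measurable_cross mS) U0 vle C2)).
apply: ler_wpM2l; first exact: hom_density_ge0.
apply: lerXn2r; rewrite ?nnegrE ?fine_ge0//.
  by rewrite mulr_ge0 ?fine_ge0.
exact: prob_cross_le.
Qed.

End sidorenko_bounds.

(** * Real inequalities *)

Section real_lemmas.
Context (R : realType).

(** If [2^-(j+1)] is the largest such power, with [j < N], below [d], then the
    term of index [j] alone is at least [d^2]; if there is none, [d <= 2^-N]. *)
Lemma dyadic_sqr_le (d : R) N : 0 <= d <= 1 ->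
  d ^+ 2 <= 4^-1 ^+ N + \sum_(j < N) 4^-1 ^+ j * (2^-1 ^+ j.+1 < d)%R%:R.
Proof.
move=> /andP[d0 d1]; elim: N => [|N ih].
  by rewrite expr0 big_ord0 addr0 expr_le1.
rewrite big_ord_recr/=; case: ltP => [_|dN].
  by rewrite mulr1 (le_trans ih)// addrC lerDr exprn_ge0.
rewrite mulr0 addr0 (@le_trans _ _ (4^-1 ^+ N.+1))//.
  rewrite (_ : 4^-1 = 2^-1 ^+ 2 :> R); last by rewrite exprVn; congr (_^-1); ring.
  by rewrite exprAC lerXn2r// nnegrE exprn_ge0.
by rewrite lerDl sumr_ge0// => j _; rewrite mulr_ge0.
Qed.

Lemma bernoulli_ineq (y : R) n : 0 <= y -> 1 + n%:R * y <= (1 + y) ^+ n.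
Proof.
move=> y0; elim: n => [|n ih]; first by rewrite mul0r addr0 expr0.
have n0 : 0 <= n%:R :> R by [].
rewrite exprS -natr1; apply: (@le_trans _ _ ((1 + y) * (1 + n%:R * y))).
  by nra.
by rewrite ler_wpM2l ?addr_ge0.
Qed.

Lemma natr_le_exp4 n : n%:R <= 4 ^+ n :> R.
Proof.
have n0 : 0 <= n%:R :> R by [].
have B := @bernoulli_ineq 3 n (ler0n _ _).
rewrite (_ : 1 + 3 = 4) in B; last by ring.
by lra.
Qed.

Lemma le_of_quarter_le (x b : R) : 4^-1 * x <= 2 * b -> x <= 8 * b.
Proof. lra. Qed.

(** The even powers of [x = 1 + y] are at least [(1 + n y)^2] by Bernoulli, which
    grows quadratically in [n] if [y > 0]. *)
Lemma le1_of_linear_growth (x a : R) : 0 <= a ->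
  (forall k, (0 < k)%N -> x ^+ k <= 1 + k%:R * a) -> x <= 1.
Proof.
move=> a0 h; rewrite leNgt; apply/negP => x1.
pose y := x - 1; have y0 : 0 < y by rewrite subr_gt0.
have y2 : 0 < y ^+ 2 by rewrite exprn_gt0.
have [n nP] : exists n : nat, (1 + 2 * a) / y ^+ 2 < n%:R.
  by exists (Num.trunc ((1 + 2 * a) / y ^+ 2)).+1; exact: truncnS_gt.
have n0 : (0 < n)%N.
  by rewrite -(ltr_nat R); apply: le_lt_trans nP;
    rewrite divr_ge0// ?addr_ge0 ?mulr_ge0// ltW.
have n1 : 1 <= n%:R :> R by rewrite ler1n.
have := h (n * 2)%N; rewrite muln_gt0 n0 => /(_ isT).
have xy : x = 1 + y by rewrite /y; ring.
have B := bernoulli_ineq n (ltW y0); rewrite -xy in B.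
rewrite exprM natrM; apply/negP; rewrite -ltNge.
rewrite ltr_pdivrMr// in nP.
apply: (@lt_le_trans _ _ ((1 + n%:R * y) ^+ 2)); last first.
  rewrite lerXn2r// nnegrE; first by rewrite addr_ge0 ?mulr_ge0 ?(ltW y0).
  by rewrite exprn_ge0// (le_trans _ (ltW x1)).
by nra.
Qed.

End real_lemmas.

(** * The second moment of the degrees *)

Section degree_moment.
Context (R : realType) (C : graphon R -> Prop) (H : sgraph).
Hypothesis C_admissible : admissible C.
Hypothesis H_sidorenko : sidorenko H C.
Hypothesis v_le_e : (nverts H <= nedges H)%N.
Implicit Type W : graphon R.

Local Notation e := (nedges H).
Local Notation s := (2 * nedges H - nverts H)%N.

Lemma nvertexponent_gt0 : (0 < nverts H)%N.
Proof.
have [u [v uv]] := adj_nonempty H; apply/card_gt0P.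
have u_core : [exists w, adj u w] by apply/existsP; exists v.
by exists (Sub u u_core).
Qed.

Lemma nedges_le_exponent : (e <= s)%N.
Proof. by rewrite leq_subRL; lia. Qed.

Lemma exponent_gt0 : (0 < s)%N.
Proof. by have := nvertexponent_gt0; move: v_le_e; lia. Qed.

Lemma measurable_deg_gt W (tau : R) : measurable [set x | tau < deg W x].
Proof.
have [md _] := bmfun_deg W.
rewrite (_ : mkset _ = deg W @^-1` `]tau, +oo[); last first.
  by apply/seteqP; split => x /=; rewrite in_itv/= andbT.
by rewrite -[X in measurable X]setTI; apply: md.
Qed.

(** For [S = {d > tau}] and [w] its degree sum, multiply
    [w^(2e) <= t^2 (2 mu(S))^s] by [w^(2(s-e)) <= p^(2(s-e))] and bound [w] below
    by [tau mu(S)]; then take [s]-th roots. *)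
Lemma deg_weak_type W (B tau : R) : C W -> 0 <= B -> 0 < tau ->
  hom_density H W ^+ 2 * edge_density W ^+ (2 * (s - e)) <= B ^+ s ->
  tau ^+ 2 * fine (gmu W [set x | tau < deg W x]) <= 2 * B.
Proof.
move=> CW B0 tau0 tB; set S := [set x | _].
have bd := bmfun_deg W.
have mS : measurable S by exact: measurable_deg_gt.
have bS : bmfun (\1_S : _ -> R) by exact: bmfun_indic.
set a := fine (gmu W S).
have [->|a_neq0] := eqVneq a 0; first by rewrite mulr0 mulr_ge0.
have a0 : 0 < a by rewrite lt_neqAle eq_sym a_neq0 fine_ge0.
have S0 : (0 < gmu W S)%E by rewrite -(fineK (fin_num_measure _ _ mS)) lte_fin.
set w := \int[gmu W]_x (\1_S x * deg W x).
have bw : bmfun (fun x => \1_S x * deg W x) by exact: bmfunM.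
have aw : tau * a <= w.
  rewrite /a -(bm_integral_indic (gmu W) mS) -bm_integralZl//.
  apply: bm_integral_le => //; first by apply: bmfunM => //; exact: bmfun_cst.
  move=> x; rewrite indicE; case: (boolP (x \in S)) => [/set_mem/ltW|_].
    by rewrite mulr1 mul1r.
  by rewrite mulr0 mul0r.
have wp : w <= edge_density W.
  rewrite edge_densityE; apply: bm_integral_le => // x.
  by rewrite ler_piMl ?deg_ge0// indicE; case: (_ \in _).
have w0 : 0 <= w by rewrite (le_trans _ aw)// mulr_ge0 ?ltW.
have vle : (nverts H <= 2 * e)%N by rewrite (leq_trans v_le_e)// leq_pmull.
have key := sidorenko_degree_sum C_admissible H_sidorenko vle CW mS S0.
rewrite -/w -/a in key.
rewrite -(@ler_pXn2r _ s) ?exponent_gt0// ?nnegrE ?mulr_ge0 ?(ltW tau0) ?(ltW a0)//.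
rewrite -(@ler_pM2r _ (a ^+ s)) ?exprn_gt0// -exprMn.
have -> : tau ^+ 2 * a * a = (tau * a) ^+ 2 by ring.
rewrite -exprM (@le_trans _ _ (w ^+ (2 * s)))//.
  by rewrite lerXn2r// nnegrE// mulr_ge0 ?ltW.
have -> : (2 * s = 2 * e + 2 * (s - e))%N by rewrite -mulnDr subnKC// nedges_le_exponent.
rewrite exprD.
apply: (@le_trans _ _ (hom_density H W ^+ 2 * (2 * a) ^+ s *
   edge_density W ^+ (2 * (s - e)))).
  by apply: ler_pM => //;
    rewrite ?exprn_ge0// lerXn2r// nnegrE// edge_density_ge0.
rewrite mulrAC !exprMn [2 ^+ s * B ^+ s]mulrC -[leRHS]mulrA ler_pM2r//.
by rewrite mulr_gt0 ?exprn_gt0.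
Qed.

(** At level [tau = 2^-(j+1)], the weak-type bound gives a dyadic term of at
    most [8 B]. *)
Lemma deg_sqr_log W (B : R) N : C W -> 0 <= B ->
  hom_density H W ^+ 2 * edge_density W ^+ (2 * (s - e)) <= B ^+ s ->
  \int[gmu W]_x deg W x ^+ 2 <= 4^-1 ^+ N + N%:R * (8 * B).
Proof.
move=> CW B0 tB.
pose A (j : nat) := [set x | 2^-1 ^+ j.+1 < deg W x].
have bA (j : nat) : bmfun (\1_(A j) : _ -> R).
  by apply: bmfun_indic; exact: measurable_deg_gt.
have bterm (j : nat) : bmfun (fun x => 4^-1 ^+ j * \1_(A j) x : R).
  by apply: bmfunM => //; exact: bmfun_cst.
have bsum : bmfun (fun x => \sum_(j < N) 4^-1 ^+ j * \1_(A j) x : R).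
  by apply: bmfun_sum => j.
apply: (@le_trans _ _ (\int[gmu W]_x (4^-1 ^+ N + \sum_(j < N) 4^-1 ^+ j * \1_(A j) x))).
  apply: bm_integral_le.
  - by apply: bmfunX; exact: bmfun_deg.
  - by apply: bmfunD => //; exact: bmfun_cst.
  move=> x; apply: (le_trans (dyadic_sqr_le N _));
    first by rewrite deg_ge0 deg_le1.
  rewrite lerD2l ler_sum// => j _; rewrite indicE ler_wpM2l ?exprn_ge0//.
  by case: (ltP _ (deg W x)) => // jx; rewrite mem_set.
rewrite bm_integralD//; last exact: bmfun_cst.
rewrite prob_integral_cst lerD2l bm_integral_sum//.
rewrite [leRHS](_ : _ = \sum_(j < N) 8 * B);
  last by rewrite sumr_const card_ord mulr_natl.
apply: ler_sum => j _; rewrite bm_integralZl// bm_integral_indic;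
  last exact: measurable_deg_gt.
have := deg_weak_type CW B0 (exprn_gt0 j.+1 (_ : 0 < 2^-1)) tB.
move=> /(_ _)/wrap[]; first by [].
rewrite exprAC -/(A j) (_ : 2^-1 ^+ 2 = 4^-1);
  last by rewrite exprVn; congr (_^-1); ring.
by rewrite exprS -mulrA; exact: le_of_quarter_le.
Qed.

(** Tensor power trick: [deg_sqr_log] for the [k]-th power, where [B] becomes
    [B^k], cut at [N = c k] so that the truncation error is at most [B^k]. *)
Lemma deg_sqr_le W (B : R) : C W -> 0 < B ->
  hom_density H W ^+ 2 * edge_density W ^+ (2 * (s - e)) <= B ^+ s ->
  \int[gmu W]_x deg W x ^+ 2 <= B.
Proof.
move=> CW B0 tB; set m := \int[_]_x _.
have [c cB] : exists c : nat, 4^-1 ^+ c <= B.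
  pose c := (Num.trunc B^-1).+1; exists c.
  rewrite exprVn -[leRHS]invrK lef_pV2 ?posrE ?invr_gt0 ?exprn_gt0//.
  apply: (le_trans (ltW (truncnS_gt _))).
  exact: natr_le_exp4.
rewrite -[leRHS]mul1r -ler_pdivrMr//.
apply: (@le1_of_linear_growth _ _ (c%:R * 8)); first by rewrite mulr_ge0.
move=> k k0; rewrite expr_div_n ler_pdivrMr ?exprn_gt0// -deg_sqr_tensor.
have Ck : C (tensor W k) by exact: adm_tensor.
have Bk : 0 <= B ^+ k by rewrite exprn_ge0// ltW.
have tBk : hom_density H (tensor W k) ^+ 2 *
    edge_density (tensor W k) ^+ (2 * (s - e)) <= (B ^+ k) ^+ s.
  rewrite hom_density_tensor edge_density_tensor.
  rewrite (exprAC _ k 2) (exprAC _ k (2 * (s - e))) -exprMn (exprAC B) lerXn2r// nnegrE.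
    by rewrite mulr_ge0 ?exprn_ge0 ?hom_density_ge0 ?edge_density_ge0.
  by rewrite exprn_ge0// ltW.
apply: (le_trans (deg_sqr_log (c * k) Ck Bk tBk)).
rewrite [leRHS]mulrDl mul1r exprM natrM lerD//.
  by rewrite lerXn2r// nnegrE ?exprn_ge0 ?ltW.
by rewrite -!mulrA mulrCA.
Qed.

End degree_moment.

(** * Normalized degrees and cuts *)

Section l2.
Context d (T : measurableType d) (R : realType) (P : probability T R).

Lemma bm_cauchy_schwarz (f g : T -> R) : bmfun f -> bmfun g ->
  (\int[P]_x (f x * g x)) ^+ 2 <=
  (\int[P]_x f x ^+ 2) * (\int[P]_x g x ^+ 2).
Proof.
move=> bf bg; set a := \int[P]_x f x ^+ 2; set c := \int[P]_x g x ^+ 2.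
set b := \int[P]_x _.
have bf2 := bmfunX 2 bf; have bg2 := bmfunX 2 bg; have bfg := bmfunM bf bg.
have a0 : 0 <= a by apply: Rintegral_ge0 => x _; exact: sqr_ge0.
have c0 : 0 <= c by apply: Rintegral_ge0 => x _; exact: sqr_ge0.
have quad (u v : R) : 0 <= u ^+ 2 * a - 2 * u * v * b + v ^+ 2 * c.
  have bZ (w : R) h : bmfun h -> bmfun (fun x : T => w * h x).
    by move=> bh; apply: bmfunM => //; exact: bmfun_cst.
  rewrite -!bm_integralZl// -bm_integralB; [|exact: bZ|exact: bZ].
  rewrite -bm_integralD; [|by apply: bmfunB; exact: bZ|exact: bZ].
  apply: Rintegral_ge0 => x _.
  by rewrite (_ : _ + _ = (u * f x - v * g x) ^+ 2) ?sqr_ge0//; ring.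
have [c_eq0|c_neq0] := eqVneq c 0.
  (* Here the claim is b = 0; these weights turn quad into (a + 2) b^2 <= 0. *)
  have q := quad b (a + 1); rewrite c_eq0 !mulr0 addr0 in q *.
  have b2 : 0 <= b ^+ 2 by exact: sqr_ge0.
  clearbody a b c; nra.
have c_gt0 : 0 < c by rewrite lt_neqAle eq_sym c_neq0.
(* The minimizer of the quadratic form, which yields c (a c - b^2) >= 0. *)
have q := quad c b.
rewrite -subr_ge0 -(pmulr_rge0 _ c_gt0) (_ : c * _ =
  c ^+ 2 * a - 2 * c * b * b + b ^+ 2 * c)//.
by ring.
Qed.

Lemma Lnorm2_sqr (f : T -> R) : bmfun f ->
  ('N[P]_2%:E[EFin \o f] ^+ 2)%E = (\int[P]_x f x ^+ 2)%:E.
Proof.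
move=> bf; have bf2 := bmfunX 2 bf.
have I0 : 0 <= \int[P]_x f x ^+ 2 by apply: Rintegral_ge0 => x _; exact: sqr_ge0.
rewrite unlock.
have -> : (\int[P]_x `|(EFin \o f) x| `^ 2)%E = (\int[P]_x f x ^+ 2)%:E.
  rewrite EFin_integral//; apply: eq_integral => x _ /=.
  by rewrite powR_mulrn// real_normK// num_real.
rewrite poweR_EFin -EFin_expe -powR_mulrn ?powR_ge0// -powRrM mulVf// powRr1//.
Qed.

End l2.

Section normalized_degree.
Context (R : realType) (W : graphon R).
Local Notation p := (edge_density W).
Local Notation f := (fun x => deg W x / p - 1).

Lemma edge_density_gt0 : nonzero W -> 0 < p.
Proof.
move=> W0; rewrite lt_neqAle edge_density_ge0 andbT eq_sym.
apply/eqP => p0; apply: W0.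
have bW := bmfun_gker W; have [mW _] := bW.
have : ae_eq (gmu W \x gmu W)%E setT (fun z => (W z.1 z.2)%:E) (cst 0%E).
  apply/ae_eq_integral_abs => //; first exact/measurable_EFinP.
  transitivity p%:E; last by rewrite p0.
  rewrite EFin_integral//; apply: eq_integral => z _.
  by rewrite gee0_abs// lee_fin gker_ge0.
by apply: filterS => z /(_ I) [].
Qed.

Hypothesis p_gt0 : 0 < p.

Lemma bmfun_normalized_deg : bmfun f.
Proof.
apply: bmfunB; last exact: bmfun_cst.
by apply: bmfunM; [exact: bmfun_deg|exact: bmfun_cst].
Qed.

Lemma normalized_deg_sqr :
  \int[gmu W]_x (deg W x / p - 1) ^+ 2 =
  (\int[gmu W]_x deg W x ^+ 2) / p ^+ 2 - 1.
Proof.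
have bd := bmfun_deg W; have bd2 := bmfunX 2 bd; have p0 := lt0r_neq0 p_gt0.
transitivity (\int[gmu W]_x (p ^- 2 * deg W x ^+ 2 - (2 / p * deg W x - 1))).
  by apply: eq_Rintegral => x _; field.
have bZ (w : R) h : bmfun h -> bmfun (fun x : gspace W => w * h x).
  by move=> bh; apply: bmfunM => //; exact: bmfun_cst.
have b1 : bmfun (fun=> 1 : R) := @bmfun_cst _ (gspace W) _ 1.
rewrite bm_integralB; [|exact: bZ|by apply: bmfunB => //; exact: bZ].
rewrite bm_integralB//; last exact: bZ.
rewrite !bm_integralZl// -edge_densityE prob_integral_cst.
by move: (\int[_]_x _) => I; field.
Qed.

(** Subtracting the constant [a] from the indicator changes nothing, since the
    normalized degree minus [1] has mean zero; it replaces [a] by the variance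
    [a (1 - a)] in the Cauchy-Schwarz bound. *)
Lemma cut_discrepancy (A : set (gspace W)) : measurable A ->
  let a := fine (gmu W A) in
  \int[(gmu W \x gmu W)%E]_(z in A `*` setT) W z.1 z.2 - p * a =
  p * \int[gmu W]_x ((\1_A x - a) * (deg W x / p - 1)).
Proof.
move=> mA a; have p0 := lt0r_neq0 p_gt0.
have bA : bmfun (\1_A : _ -> R) by exact: bmfun_indic.
have bd := bmfun_deg W; have bW := bmfun_gker W.
have bAW : bmfun (fun z : gspace W * gspace W => \1_A z.1 * W z.1 z.2 : R).
  by apply: bmfunM => //; exact: (bmfun_comp bA).
have -> : \int[(gmu W \x gmu W)%E]_(z in A `*` setT) W z.1 z.2 =
    \int[gmu W]_x (\1_A x * deg W x).
  rewrite Rintegral_mkcond.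
  transitivity (\int[(gmu W \x gmu W)%E]_z (\1_A z.1 * W z.1 z.2)).
    apply: eq_Rintegral => z _; rewrite patchE indicE.
    have -> : (z \in A `*` setT) = (z.1 \in A).
      by apply/idP/idP => /set_mem; [case => zA _|move=> zA]; apply/mem_set.
    by case: ifP; rewrite ?mul1r ?mul0r.
  rewrite (bm_fubini1 _ _ bAW); apply: eq_Rintegral => x _.
  by rewrite -bm_integralZl//; exact: (bmfun_sectionl bW).
have bZ (w : R) h : bmfun h -> bmfun (fun x : gspace W => w * h x).
  by move=> bh; apply: bmfunM => //; exact: bmfun_cst.
have bAd : bmfun (fun x => \1_A x * deg W x) by exact: bmfunM.
transitivity (p * \int[gmu W]_x (p^-1 * (\1_A x * deg W x) -
   (a / p * deg W x + (\1_A x - a)))); last first.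
  by congr (_ * _); apply: eq_Rintegral => x _; field.
have ba : bmfun (fun=> a) := @bmfun_cst _ (gspace W) _ a.
have bAa : bmfun (fun x => \1_A x - a) by exact: bmfunB.
rewrite bm_integralB; [|exact: bZ|by apply: bmfunD => //; exact: bZ].
rewrite bm_integralD//; last exact: bZ.
rewrite bm_integralB// !bm_integralZl// -edge_densityE prob_integral_cst.
rewrite bm_integral_indic// -/a.
by move: (\int[_]_x _) => I; field.
Qed.

Lemma indic_variance (A : set (gspace W)) : measurable A ->
  let a := fine (gmu W A) in
  \int[gmu W]_x (\1_A x - a) ^+ 2 = a * (1 - a).
Proof.
move=> mA a; have bA : bmfun (\1_A : _ -> R) by exact: bmfun_indic.
transitivity (\int[gmu W]_x ((1 - 2 * a) * \1_A x + a ^+ 2)).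
  apply: eq_Rintegral => x _; rewrite indicE.
  by case: (x \in A) => /=; ring.
rewrite bm_integralD; last 2 first.
- by apply: bmfunM => //; exact: bmfun_cst.
- exact: bmfun_cst.
rewrite bm_integralZl// prob_integral_cst bm_integral_indic// -/a.
by ring.
Qed.

End normalized_degree.

Theorem corollary6p2 (R : realType) (C : graphon R -> Prop) (H : sgraph)
    (W : graphon R)
    (C_admissible : admissible C)
    (H_sidorenko : sidorenko H C)
    (v_le_e : (nverts H <= nedges H)%N)
    (CW : C W)
    (W_nonzero : nonzero W) :
  let s := (2 * nedges H - nverts H)%N in
  let p := edge_density W in
  let gap := sidorenko_ratio H W `^ (2 / s%:R) - 1 in
  ('N[gmu W]_2%:E[EFin \o (fun x => deg W x / p - 1)%R] ^+ 2 <= gap%:E)%E /\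
  forall A : set (gspace W), measurable A ->
    let a := fine (gmu W A) in
    `| \int[(gmu W \x gmu W)%E]_(z in A `*` setT) W z.1 z.2 - p * a |
      <= p * Num.sqrt (a * (1 - a)) * Num.sqrt gap.
Proof.
move=> s p gap.
have p0 : 0 < p by exact: edge_density_gt0.
have t0 : 0 < hom_density H W.
  have h : p ^+ nedges H <= hom_density H W by exact: H_sidorenko.
  by apply: lt_le_trans h; rewrite exprn_gt0.
set r := sidorenko_ratio H W in gap *.
have r0 : 0 < r by rewrite divr_gt0 ?exprn_gt0.
have s0 : (0 < s)%N by exact: exponent_gt0.
have es : (nedges H <= s)%N by exact: nedges_le_exponent.
pose B := p ^+ 2 * r `^ (2 / s%:R).
have Bs : hom_density H W ^+ 2 * p ^+ (2 * (s - nedges H)) = B ^+ s.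
  rewrite exprMn -[in RHS](powR_mulrn _ (powR_ge0 _ _)) -powRrM divfK; last first.
    by rewrite pnatr_eq0 -lt0n.
  rewrite powR_mulrn ?(ltW r0)// /r /sidorenko_ratio expr_div_n -/p.
  rewrite -!exprM (mulnC _ 2) -[in RHS](subnKC es) mulnDr exprD.
  by rewrite [RHS]mulrC mulrA divfK// expf_neq0// lt0r_neq0.
have B0 : 0 < B by rewrite mulr_gt0 ?exprn_gt0 ?powR_gt0.
have mB : \int[gmu W]_x deg W x ^+ 2 <= B.
  by apply: (deg_sqr_le C_admissible H_sidorenko v_le_e CW B0); rewrite Bs.
have bf := bmfun_normalized_deg W.
have var_le : \int[gmu W]_x (deg W x / p - 1) ^+ 2 <= gap.
  rewrite (normalized_deg_sqr p0) lerD2r ler_pdivrMr ?exprn_gt0// mulrC.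
  exact: mB.
split; first by rewrite (Lnorm2_sqr (gmu W) bf) lee_fin.
move=> A mA /=; set a := fine (gmu W A).
rewrite (cut_discrepancy p0 mA) normrM (gtr0_norm p0) -/a -mulrA ler_pM2l//.
rewrite -sqrtr_sqr -sqrtrM; last first.
  by rewrite -(indic_variance mA); apply: Rintegral_ge0 => x _; exact: sqr_ge0.
apply: ler_wsqrtr; rewrite -(indic_variance mA).
have bA : bmfun (fun x => \1_A x - a).
  by apply: bmfunB; [exact: bmfun_indic|exact: bmfun_cst].
apply: (le_trans (bm_cauchy_schwarz (gmu W) bA bf)).
by apply: ler_wpM2l => //; apply: Rintegral_ge0 => x _; exact: sqr_ge0.
Qed.
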